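(* Let $d,\ell\geq1$ be integers and let $\mathcal{Q}=\{Q_{ij}\}_{1\leq i\leq d,\,1\leq j\leq\ell}$ be a collection of $\ell d$ polynomials in $\mathbb{Z}[r]$, with $k=\max_{i,j}\deg Q_{ij}\geq1$. There exists a constant $C_{\ell,d,k}=C_{\ell,d,k}(\mathcal{Q})$ such that if $N$ is sufficiently large (depending on $\mathcal{Q}$) and $A\subseteq[1,N]^d$ satisfies \[\frac{|A|}{N^d}\geq C_{\ell,d,k}\,N^{-1/(\ell k)},\] then there exist $r',r''\in\mathbb{N}$ with $r'\neq r''$ such that for every $1\leq j\leq\ell$, \[\sum_{i=1}^d\bigl(Q_{ij}(r')-Q_{ij}(r'')\bigr)e_i\in A-A.\]
   Context: $e_1,\dots,e_d$ are the standard basis vectors of $\mathbb{Z}^d$; $[1,N]=\{1,\dots,N\}$ and $[1,N]^d$ its $d$-fold product; $A-A=\{a-a':a,a'\in A\}$. *)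

(* Defs.v *)
From HB Require Import structures.
From mathcomp Require Import all_boot all_order all_algebra.
From mathcomp Require Import finmap reals exp.

Set Implicit Arguments.
Unset Strict Implicit.
Unset Printing Implicit Defensive.

Import Order.TTheory GRing.Theory Num.Theory.

Local Open Scope ring_scope.
Local Open Scope fset_scope.

Definition box (d N : nat) : pred 'rV[int]_d :=
  fun x => [forall i : 'I_d, 1 <= x 0 i <= N%:Z].

Definition diffset (d : nat) (A : {fset 'rV[int]_d}) : {fset 'rV[int]_d} :=
  [fset a - a' | a in A, a' in A].

(* The zero polynomial gets degree 0 here; this does not affect a maximum that
   is required to be at least 1. *)
Definition maxdeg (d l : nat) (Q : 'I_d -> 'I_l -> {poly int}) : nat :=
  \max_(i < d) \max_(j < l) (size (Q i j)).-1.

(* Main.v *)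
Require Import Defs.
From HB Require Import structures.
From mathcomp Require Import all_boot all_order all_algebra.
From mathcomp Require Import finmap reals exp.
From mathcomp Require Import zify.

(** Write [q_j(r) = \sum_i Q_ij(r) e_i], and let [r] range over [1, M] with
    [M] the integer part of [N^(1/k)], so that every [|Q_ij(r)|] is [O(N)].
    The translates [(a_j + q_j(r))_j] with [a] in [A^l] all lie in a box of
    [O(N)^(d l)] points of [Z^(d l)], while there are [M |A|^l] pairs [(r, a)].
    When [|A|] exceeds a large multiple of [N^(d - 1/(l k))] two of these pairs
    give the same point, and their [r]-components must differ because equality of
    these would force equality of the [a]-components. *)

Set Implicit Arguments.
Unset Strict Implicit.
Unset Printing Implicit Defensive.

Import Order.TTheory GRing.Theory Num.Theory.

Local Open Scope ring_scope.
Local Open Scope fset_scope.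

(** For [x >= 1] every power of [x] occurring in [p] is at most [x ^+ k]. *)
Lemma norm_horner_le (F : numDomainType) (p : {poly F}) (k : nat) (x : F) :
  ((size p).-1 <= k)%N -> 1 <= x ->
  `|p.[x]| <= (\sum_(i < size p) `|p`_i|) * x ^+ k.
Proof.
move=> sz_p x_ge1; rewrite horner_coef mulr_suml.
apply: le_trans (ler_norm_sum _ _ _) _; apply: ler_sum => i _.
have x_ge0 : 0 <= x by apply: le_trans x_ge1.
rewrite normrM normrX (ger0_norm x_ge0) ler_wpM2l //.
by apply: ler_weXn2l => //; have := ltn_ord i; lia.
Qed.

Lemma size_le_maxdeg (d l : nat) (Q : 'I_d -> 'I_l -> {poly int}) i j :
  ((size (Q i j)).-1 <= maxdeg Q)%N.
Proof.
rewrite /maxdeg; apply: leq_trans (leq_bigmax i).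
exact: (leq_bigmax (F := fun j => (size (Q i j)).-1) j).
Qed.

(** Summing the absolute values of all coefficients of all the polynomials gives one [B] that serves
    every [i] and [j]. *)
Lemma maxdeg_bound (d l : nat) (Q : 'I_d -> 'I_l -> {poly int}) :
  exists B : nat, forall i j (r : nat), (0 < r)%N ->
    `|(Q i j).[r%:Z]| <= (B * r ^ maxdeg Q)%N%:Z.
Proof.
pose S i j := \sum_(m < size (Q i j)) `|(Q i j)`_m|.
have S_ge0 i j : 0 <= S i j by apply: sumr_ge0.
exists (\sum_i \sum_j `|S i j|)%N => i j r r_gt0.
apply: le_trans (norm_horner_le (size_le_maxdeg Q i j) _) _; first by lia.
rewrite PoszM -[Posz (r ^ _)]natz natrX natz; apply: ler_wpM2r; first by rewrite exprn_ge0.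
rewrite -/(S i j) -[S i j]gez0_abs // lez_nat.
by rewrite (bigD1 i) //= (bigD1 j) //= -addnA leq_addr.
Qed.

Lemma sum_scale_delta (T : pzRingType) (d : nat) (f : 'I_d -> T) :
  \sum_(i < d) f i *: delta_mx 0 i = \row_i f i.
Proof.
by rewrite [RHS]row_sum_delta; apply: eq_bigr => i _; rewrite mxE.
Qed.

(** The pigeonhole step, for arbitrary functions [q] bounded by [W] on [[1, M]]: each of the [l * d]
    coordinates of a translate lies in [[-W, N + W]], an interval of [N + 2W + 1] integers. *)
Lemma collision (d l N M W : nat) (A : {fset 'rV[int]_d})
    (q : 'I_d -> 'I_l -> nat -> int) :
  {subset A <= box (d:=d) N} ->
  (forall i j r, (0 < r <= M)%N -> `|q i j r| <= W%:Z) ->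
  ((N + W.*2).+1 ^ (l * d) < M * #|` A| ^ l)%N ->
  exists r' r'' : nat,
    [/\ (0 < r')%N, (0 < r'')%N, r' <> r''
      & forall j, \row_i (q i j r' - q i j r'') \in diffset A].
Proof.
move=> sAbox q_le card_gt.
(* Elements of ['I_M] start at 0, so [u.1.+1] runs over [[1, M]]. *)
pose pt (u : 'I_M * {ffun 'I_l -> A}) (j : 'I_l) (i : 'I_d) : int :=
  (val (u.2 j) 0 i + q i j u.1.+1)%R.
(* Adding [W] makes every coordinate nonnegative and at most [N + 2W], so neither the absolute value
   nor [inord] loses information. *)
pose F u : {ffun 'I_l * 'I_d -> 'I_(N + W.*2).+1} :=
  [ffun ji => inord `|(pt u ji.1 ji.2 + W%:Z)%R|%N].
have pt_range u j i : (- W%:Z <= pt u j i <= N%:Z + W%:Z)%R.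
  have /forallP/(_ i) := sAbox _ (valP (u.2 j)).
  have := q_le i j u.1.+1 (ltn_ord u.1).
  rewrite /pt; set x := fun_of_matrix _ _ _; set y := q _ _ _.
  by lia.
have F_inj u v : F u = F v -> forall j i, pt u j i = pt v j i.
  move=> /ffunP Fuv j i; have /(congr1 val) := Fuv (j, i).
  have := pt_range u j i; have := pt_range v j i.
  by rewrite !ffunE /= => ? ?; rewrite !inordK; lia.
have [/injectiveP/leq_card | /injectivePn[u [v neq_uv /F_inj pt_eq]]] :=
  boolP (injectiveb F).
  rewrite card_prod !card_ffun !card_prod !card_ord => le_card.
  by move: card_gt; rewrite ltnNge cardfE le_card.
exists u.1.+1, v.1.+1; split=> // [/succn_inj/val_inj eq1 | j].
  case/eqP: neq_uv; case: u v pt_eq eq1 => [r a] [s b] /= pt_eq eq_rs.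
  subst s; congr pair; apply/ffunP => j; apply/val_inj/rowP => i.
  by have := pt_eq j i; rewrite /pt /= => /addIr.
(* From [a_j + q_j(r') = b_j + q_j(r'')], the difference of the [q_j] is [b_j - a_j]: the point of
   [v] comes first. *)
apply/imfset2P; exists (val (v.2 j)); first exact: valP.
exists (val (u.2 j)); first exact: valP.
apply/rowP => i; rewrite !mxE; have := pt_eq j i; rewrite /pt => pt_eq_ji.
by apply/eqP; rewrite subr_eq addrAC -pt_eq_ji addrAC subrr add0r.
Qed.

Theorem theorem3p3 (R : realType) (d l : nat) (hd : (1 <= d)%N) (hl : (1 <= l)%N)
    (Q : 'I_d -> 'I_l -> {poly int}) (k : nat) (hkQ : k = maxdeg Q)
    (hk : (1 <= k)%N) :
  exists (C : R) (N0 : nat), forall N : nat, (N0 <= N)%N ->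
    forall A : {fset 'rV[int]_d},
      {subset A <= box (d:=d) N} ->
      (#|` A|)%:R / N%:R ^+ d >= C * N%:R `^ (- ((l * k)%N%:R)^-1) ->
      exists r' r'' : nat,
        [/\ (1 <= r')%N, (1 <= r'')%N, r' <> r''
          & forall j : 'I_l,
              \sum_(i < d) ((Q i j).[r'%:Z] - (Q i j).[r''%:Z]) *: delta_mx 0 i
                \in diffset A].
Proof.
have [B] := maxdeg_bound Q; rewrite -hkQ => Q_le.
(* Chosen so that [N + 2BN + 1 <= c * N] once [N >= 1]. The factor 2 in the constant below pays for
   rounding [t ^+ l] down to [M]. *)
pose c := (B.*2.+2)%N.
exists (2 * c%:R ^+ d), 1%N => N N_gt0 A sAbox dens.
have NR_gt0 : 0 < N%:R :> R by rewrite ltr0n.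
(* With [t] the [l * k]-th root of [N], the density hypothesis becomes [2 (c N)^d <= |A| t], and
   [t ^+ l] is the [k]-th root of [N]. *)
pose t : R := N%:R `^ ((l * k)%N%:R)^-1.
have t_gt0 : 0 < t by apply: powR_gt0.
have lk_neq0 : (l * k)%N%:R != 0 :> R by rewrite pnatr_eq0; lia.
have tX : t ^+ (l * k) = N%:R.
  by rewrite /t -powR_mulrn ?powR_ge0 // -powRrM mulVf // powRr1 // ltW.
have t_ge1 : 1 <= t.
  have lk_gt0 : (0 < l * k)%N by lia.
  by rewrite -(expr_ge1 lk_gt0) ?(ltW t_gt0) // tX ler1n.
have tl_ge1 : 1 <= t ^+ l by apply: exprn_ege1.
have /andP[M_le M_gt] := truncn_itv (le_trans ler01 tl_ge1).
move: (Num.truncn _) M_le M_gt => M M_le M_gt.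
have Mk_le : (M ^ k <= N)%N.
  by rewrite -(ler_nat R) natrX -tX exprM lerXn2r ?nnegrE ?exprn_ge0 ?(ltW t_gt0).
have M_gt0 : (0 < M)%N by rewrite -ltnS -(ltr_nat R); apply: le_lt_trans M_gt.
have tl_lt : t ^+ l < 2 * M%:R.
  by apply: lt_le_trans M_gt _; rewrite -natrM ler_nat; lia.
have [||r' [r'' [r'_gt0 r''_gt0 neq_r inA]]] :=
  @collision d l N M (B * N) A (fun i j r => (Q i j).[r%:Z]) sAbox.
- move=> i j r /andP[r_gt0 r_le]; apply: le_trans (Q_le i j r r_gt0) _.
  by rewrite lez_nat leq_mul2l (leq_trans _ Mk_le) ?orbT ?leq_exp2r.
- apply: (@leq_ltn_trans ((c * N) ^ (l * d))).
    by rewrite leq_exp2r ?muln_gt0 ?hl // /c; nia.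
  rewrite -(ltr_nat R) natrM !natrX natrM.
  move: dens; rewrite powRN -/t ler_pdivlMr ?exprn_gt0 //.
  set a : R := #|` A|%:R; rewrite mulrAC ler_pdivrMr // => dens.
  have a_gt0 : 0 < a.
    rewrite -(pmulr_lgt0 _ t_gt0); apply: lt_le_trans dens.
    by rewrite !mulr_gt0 ?exprn_gt0 // ltr0n.
  (* The [l]-th power of the density bound; it yields a factor [2 ^ l], which is at least 2 because
     [l >= 1]. *)
  have X_le : 2 * (c%:R * N%:R) ^+ (l * d) <= a ^+ l * t ^+ l.
    rewrite -exprMn; apply: le_trans (_ : (2 * c%:R ^+ d * N%:R ^+ d) ^+ l <= _).
      rewrite -mulrA -exprMn mulnC exprM [leRHS]exprMn ler_wpM2r //.
        by rewrite !(exprn_ge0, mulr_ge0).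
      by rewrite ler_eXnr // ler1n.
    by rewrite lerXn2r ?nnegrE ?(mulr_ge0, exprn_ge0) ?(ltW a_gt0) ?(ltW t_gt0).
  have : a ^+ l * t ^+ l < a ^+ l * (2 * M%:R) by rewrite ltr_pM2l ?exprn_gt0.
  by move/(le_lt_trans X_le); rewrite mulrCA ltr_pM2l // [a ^+ l * _]mulrC.
by exists r', r''; split=> // j; rewrite sum_scale_delta.
Qed.
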